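(* Let $A\in\mathbb{C}^{n\times n}$ with $\mathrm{ind}(A)=k>0$ and let $B\in\mathbb{C}^{n\times n}$ with $\mathrm{ind}(B)=s$. If $B$ is a stable perturbation of $A$, then $$\frac{\|B^{\odot}-A^{\odot}\|}{\|A^{\odot}\|}\le\frac{\|W_1^{-1}\|\,\|W_2^{-1}\|}{\|A^{\odot}\|}\big(\|G_1\|+\|A^{\odot}\|\,\|G_2\|\big),$$ where $G_1=A^{\odot}-(I+YZ-Z)A^{\odot}(I+Z^*Z-Z^* )$ and $G_2=(I+E_BA^{\odot})^{-1}-I$. Furthermore, if $\|Z\|<1$ and $\|YZ\|<1$, then $$\frac{\|B^{\odot}-A^{\odot}\|}{\|A^{\odot}\|}\le\frac{1+\|Z\|}{\|A^{\odot}\|(1-\|Z\|)(1-\|YZ\|)}\big(\|G_1\|+\|A^{\odot}\|\,\|G_2\|\big)\le\frac{1+\|Z\|}{(1-\|Z\|)(1-\|YZ\|)}\big(1+\alpha\beta+\|G_2\|\big),$$ where $\alpha=1+\|Z\|+\|YZ\|$ and $\beta=1+\|Z\|+\|Z\|^2$.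
   Context: $\|\cdot\|$ denotes the spectral norm, $(\cdot)^*$ the conjugate transpose and $\mathrm{rk}$ the rank. The index $\mathrm{ind}(M)$ of a square matrix $M$ is the smallest nonnegative integer $m$ with $\mathrm{rk}(M^{m+1})=\mathrm{rk}(M^m)$ (with $M^0=I$), so $\mathrm{ind}(M)>0$ exactly when $M$ is singular. For $M\in\mathbb{C}^{n\times n}$ with $\mathrm{ind}(M)=m$, $M^{\odot}$ denotes the core-EP inverse of $M$: the unique $X\in\mathbb{C}^{n\times n}$ with $XM^{m+1}=M^m$, $MX^2=X$, $(MX)^*=MX$. Put $M^{\pi}:=I-MM^{\odot}$. $B$ is a stable perturbation of $A$ (with respect to the core-EP inverse) if $I-(B^{\pi}-A^{\pi})^2$ is nonsingular. Notation: $L_B=B^2B^{\odot}$, $E_B=L_B-A$, $F_B=L_B-A^*$, $$Y=\big(I+(A^{\odot})^*F_B\big)^{-1}(A^{\odot})^*F_BA^{\pi},\qquad Z=A^{\pi}E_BA^{\odot}\big(I+E_BA^{\odot}\big)^{-1},$$ $$W_1=(I+YZ)(I-Z),\qquad W_2=(I-Z^* )(I+Z^*Z).$$ It is known that, when $B$ is a stable perturbation of $A$, the matrices $I+E_BA^{\odot}$, $I+(A^{\odot})^*F_B$, $I+YZ$, $W_1$ and $W_2$ are nonsingular, so everything is well defined. *)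

(* Defs.v *)
From HB Require Import structures.
From mathcomp Require Import all_boot all_order all_algebra.
From mathcomp Require Import boolp classical_sets reals.
From mathcomp Require Export complex.

Set Implicit Arguments.
Unset Strict Implicit.
Unset Printing Implicit Defensive.

Import Order.TTheory GRing.Theory Num.Theory.

Local Open Scope classical_set_scope.
Local Open Scope ring_scope.
Local Open Scope sesquilinear_scope.

Section Index.
Variables (F : fieldType) (n : nat).
Implicit Types M : 'M[F]_n.

Lemma mx_index_subproof M : exists m, \rank (M ^+ m.+1) == \rank (M ^+ m).
Proof.
case: (pselect (exists m, \rank (M ^+ m.+1) == \rank (M ^+ m))) => // nE.
have le_rk m : (\rank (M ^+ m) + m <= n)%N.
  elim: m => [|m IHm]; first by rewrite addn0 rank_leq_row.
  apply: leq_trans IHm; rewrite addnS -addSn leq_add2r ltn_neqAle.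
  apply/andP; split; first by apply/negP => eq_rk; apply: nE; exists m.
  by rewrite exprS; exact: mxrankM_maxr.
by have := le_rk n.+1; rewrite addnS ltnNge leq_addl.
Qed.

Definition mx_index M : nat := ex_minn (mx_index_subproof M).

End Index.

Section SpectralNorm.
Variable R : realType.

Definition l2norm n (x : 'cV[R[i]]_n) : R :=
  Num.sqrt (\sum_(j < n) Normc.normc (x j 0) ^+ 2).

(* Operator norm induced by the Euclidean norms. *)
Definition spectral_norm m n (M : 'M[R[i]]_(m, n)) : R :=
  sup [set l2norm (M *m x) | x in [set x : 'cV[R[i]]_n | l2norm x <= 1]].

End SpectralNorm.

Section CoreEP.
Variables (R : realType) (n : nat).
Implicit Types M X : 'M[R[i]]_n.

Definition is_core_EP M X : Prop :=
  [/\ X *m M ^+ (mx_index M).+1 = M ^+ mx_index M,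
      M *m X ^+ 2 = X &
      (M *m X) ^t* = M *m X].

(* The default value 0 is never reached: see core_EPP and is_core_EP_uniq. *)
Definition core_EP M : 'M[R[i]]_n := xget 0 [set X | is_core_EP M X].

Lemma is_core_EP_uniq M X X' : is_core_EP M X -> is_core_EP M X' -> X = X'.
Proof.
set m := mx_index M; rewrite /is_core_EP -/m.
have iterE Y j : M *m Y ^+ 2 = Y -> Y = M ^+ j *m Y ^+ j.+1.
  move=> Y2; elim: j => [|j IHj]; first by rewrite expr0 expr1 mul1mx.
  have MY : M *m Y ^+ j.+2 = Y ^+ j.+1.
    by rewrite (exprD Y 2 j) -mulmxE mulmxA Y2 exprS.
  by rewrite (exprSr M j) -mulmxE -mulmxA MY.
have absorb Y : Y *m M ^+ m.+1 = M ^+ m -> M *m Y ^+ 2 = Y ->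
    M *m Y *m M ^+ m = M ^+ m.
  move=> Y1 Y2; rewrite -[in LHS]Y1 -[_ *m (Y *m _)]mulmxA [Y *m (Y *m _)]mulmxA.
  by rewrite -[Y *m Y]/(Y ^+ 2) mulmxA Y2.
move=> [X1 X2 X3] [Y1 Y2 Y3].
have MYE Y : M *m Y ^+ 2 = Y -> M *m Y = M ^+ m.+1 *m Y ^+ m.+1.
  by move=> MYY; rewrite {1}(iterE _ m MYY) mulmxA (exprS M).
have prodE Y Y' : M *m Y *m M ^+ m = M ^+ m -> M *m Y' ^+ 2 = Y' ->
    M *m Y *m (M *m Y') = M *m Y'.
  move=> YP /MYE ->.
  by rewrite (exprSr M) -mulmxE -[M ^+ m *m M *m _]mulmxA [LHS]mulmxA YP.
have eqMX : M *m X = M *m X'.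
  have e1 := prodE X' X (absorb _ Y1 Y2) X2.
  have e2 := prodE X X' (absorb _ X1 X2) Y2.
  rewrite -Y3 -e2 trmx_mul map_mxM /= Y3 X3.
  by rewrite e1.
have stepE Y : Y *m M ^+ m.+1 = M ^+ m -> forall Y', M *m Y' ^+ 2 = Y' ->
    Y *m (M *m Y') = Y'.
  move=> Y1' Y' Y'2.
  by rewrite (MYE _ Y'2) mulmxA Y1' -iterE.
by rewrite -(stepE _ X1 _ X2) eqMX (stepE _ X1 _ Y2).
Qed.

Lemma gram_unit p q (V : 'M[R[i]]_(p, q)) :
  \rank V = q -> V ^t* *m V \in unitmx.
Proof.
move=> rkV; rewrite -row_free_unit -kermx_eq0.
apply/rowV0P => u /sub_kermxP uG.
have : u *m V ^t* = 0.
  apply/eqP; apply: contraT => /dotmx_is_dotmx; rewrite dotmxE.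
  rewrite trmx_mul map_mxM /= trmxCK mulmxA -(mulmxA u) uG mul0mx mxE.
  by rewrite ltxx.
move/eqP; rewrite mulmx_free_eq0; first by move/eqP.
by rewrite /row_free mxrank_map mxrank_tr rkV.
Qed.

Lemma core_EP_exists M : exists X, is_core_EP M X.
Proof.
rewrite /is_core_EP; set m := mx_index M.
have rkM : \rank (M ^+ m.+1) = \rank (M ^+ m).
  by rewrite /m /mx_index; case: ex_minnP => j /eqP.
set P := M ^+ m.
have [r [V [H [K [PE HK rkV rkP]]]]] :
    exists r (V : 'M_(n, r)) (H : 'M_(r, n)) (K : 'M_(n, r)),
    [/\ V *m H = P, H *m K = 1%:M, \rank V = r & \rank P = r].
  exists (\rank P), (col_base P), (row_base P), (pinvmx (row_base P)).
  split=> //; first exact: mulmx_base.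
  - by rewrite mulmxVp // row_base_free.
  - by apply/eqP; exact: (col_base_full P).
pose T := H *m M *m K.
have MP : M *m P = P *m M by rewrite /P !mulmxE -exprS exprSr.
have MV : M *m V = V *m T.
  rewrite -[V in LHS]mulmx1 -HK [V *m (_ *m _)]mulmxA PE mulmxA MP -PE.
  by rewrite /T !mulmxA.
have MPE : M ^+ m.+1 = V *m T *m H.
  by rewrite exprS -mulmxE -/P -PE mulmxA MV.
have Tu : T \in unitmx.
  rewrite -row_full_unit /row_full eqn_leq rank_leq_row /= -[X in (X <= _)%N]rkP -rkM.
  rewrite MPE -mulmxA (leq_trans (mxrankM_maxr _ _)) // mxrankM_maxl //.
have Gu := gram_unit rkV; set G := V ^t* *m V in Gu.
clearbody T.
exists (V *m invmx T *m invmx G *m V ^t*).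
have MX : M *m (V *m invmx T *m invmx G *m V ^t*) = V *m invmx G *m V ^t*.
  by rewrite !mulmxA MV mulmxK.
split.
- rewrite MPE -PE -!mulmxA [V ^t* *m (V *m _)]mulmxA -/G.
  by rewrite (mulKmx Gu) (mulKmx Tu).
- rewrite expr2 -mulmxE mulmxA MX -!mulmxA [V ^t* *m (V *m _)]mulmxA -/G.
  by rewrite (mulKmx Gu).
- rewrite MX !trmx_mul !map_mxM /= trmxCK -mulmxA; congr (_ *m (_ *m _)).
  rewrite trmx_inv map_invmx; congr invmx.
  by rewrite /G trmx_mul map_mxM /= trmxCK.
Qed.

Lemma core_EPP M : is_core_EP M (core_EP M).
Proof. by have [X MX] := core_EP_exists M; exact: (xgetI 0 MX). Qed.

End CoreEP.

Section StablePerturbation.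
Variables (R : realType) (n : nat).
Implicit Types A B M : 'M[R[i]]_n.

Definition core_EP_pi M : 'M[R[i]]_n := 1%:M - M *m core_EP M.

Definition stable_perturbation A B : Prop :=
  1%:M - (core_EP_pi B - core_EP_pi A) ^+ 2 \in unitmx.

Definition pertL B : 'M[R[i]]_n := B ^+ 2 *m core_EP B.
Definition pertE A B : 'M[R[i]]_n := pertL B - A.
Definition pertF A B : 'M[R[i]]_n := pertL B - A ^t*.

Definition pertY A B : 'M[R[i]]_n :=
  invmx (1%:M + (core_EP A) ^t* *m pertF A B)
    *m (core_EP A) ^t* *m pertF A B *m core_EP_pi A.

Definition pertZ A B : 'M[R[i]]_n :=
  core_EP_pi A *m pertE A B *m core_EP A
    *m invmx (1%:M + pertE A B *m core_EP A).

Definition pertW1 A B : 'M[R[i]]_n :=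
  (1%:M + pertY A B *m pertZ A B) *m (1%:M - pertZ A B).

Definition pertW2 A B : 'M[R[i]]_n :=
  (1%:M - (pertZ A B) ^t*) *m (1%:M + (pertZ A B) ^t* *m pertZ A B).

End StablePerturbation.

(* Main.v *)
Require Import Defs.
From HB Require Import structures.
From mathcomp Require Import all_boot all_order all_algebra.
From mathcomp Require Import boolp classical_sets reals.

Import Order.TTheory GRing.Theory Num.Theory.

Local Open Scope ring_scope.
Local Open Scope sesquilinear_scope.

(** Write X for the core-EP inverse of A, V for that of B, P = A X and Q = B V
    for the orthogonal projectors onto the ranges of large powers of A and B,
    and L = B B V for the core part of B.  X is at once the group inverse
    and the Moore-Penrose inverse of A A X, and V that of L ([core_EP_pair]);
    the indices of A and B enter the proof only through this fact.

    Stability says that D = 1 - (P - Q)^2 is invertible.  As D commutes with P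
    and Q, the matrix Pi = Q P D^-1 is then the oblique projector onto the
    range of Q along the kernel of P ([oblique_proj_mulrQ] and its
    companions).  With N = 1 + E X, where E = L - A, one finds Pi N = L X,
    and from this both that N is invertible and that Z = Pi - P
    ([resolvent_projC]).  The same computation applied to the adjoint of L
    gives the adjoint of Y in place of Z, hence Y = Z^* ([stable_Y_adj]).
    Therefore, with S = 1 + Z^* Z, one has W1 = S (1 - Z) and W2 = W1^*.

    The heart of the proof is the exact factorization W1 V W1^* = X N^-1
    ([stable_factor]): W1 acts on the range of Q as Pi^*, because
    W1 Pi = Pi^* Pi, so both sides reduce to Pi^* V Pi.  It gives
      V - X = W1^-1 (X N^-1 - W1 X W2) W2^-1 = W1^-1 (G1 + X G2) W2^-1,
    and the first bound is submultiplicativity of the norm.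

    Because Z squares to zero, W1^-1 = (1 + Z) S^-1, and S >= 1 makes S^-1 a
    contraction.  So the norms of W1^-1 and W2^-1 are both at most
    1 + |Z|, which is better than what the Neumann series for 1 + Y Z
    gives, and (1 + |Z|)(1 - |Z|) <= 1 turns (1 + |Z|)^2 into the stated
    coefficient.  The last bound expands W1 = 1 + Y Z - Z and
    W2 = 1 + Z^* Z - Z^* in G1 = X - W1 X W2. *)

(** * Scalar estimates *)

Section ScalarEstimates.
Set Implicit Arguments.
Unset Strict Implicit.
Context {K : realFieldType}.

Lemma sqr_le_coef (z y : K) : 0 <= z -> 0 <= y -> z < 1 -> y < 1 ->
  (1 + z) * (1 + z) <= (1 + z) / ((1 - z) * (1 - y)).
Proof.
move=> z0 y0 z1 y1.
have zB0 : 0 < 1 - z by rewrite subr_gt0.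
have yB0 : 0 < 1 - y by rewrite subr_gt0.
have zD0 : 0 <= 1 + z by rewrite addr_ge0.
(* Cancelling 1 + z, it remains to see (1 + z)(1 - z)(1 - y) <= 1. *)
rewrite ler_wpM2l // -div1r ler_pdivlMr ?mulr_gt0 // mulrA.
rewrite mulr_ile1 ?mulr_ge0 ?(ltW zB0) ?(ltW yB0) //; last by rewrite gerBl.
by rewrite mulrC -subr_sqr expr1n gerBl sqr_ge0.
Qed.

(** The passage from the bound on the difference d to the relative bounds,
    with x, z and y for the norms of the core-EP inverse, of Z and of Y Z.
    Everything remains true at x = 0, where the quotients by x are 0. *)
Lemma relative_estimates (d x z y w1 w2 g1 g2 ab : K) :
    0 <= x -> 0 <= z -> 0 <= y -> 0 <= w1 -> 0 <= w2 -> 0 <= g1 -> 0 <= g2 ->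
    0 <= ab -> d <= w1 * w2 * (g1 + x * g2) -> w1 <= 1 + z -> w2 <= 1 + z ->
    g1 <= x * (1 + ab) ->
  d / x <= w1 * w2 / x * (g1 + x * g2) /\
  (z < 1 -> y < 1 ->
     d / x <= (1 + z) / (x * (1 - z) * (1 - y)) * (g1 + x * g2) /\
     (1 + z) / (x * (1 - z) * (1 - y)) * (g1 + x * g2) <=
       (1 + z) / ((1 - z) * (1 - y)) * (1 + ab + g2)).
Proof.
move=> x0 z0 y0 w10 w20 g10 g20 ab0 dw w1z w2z g1x.
have xV0 : 0 <= x^-1 by rewrite invr_ge0.
split; first by rewrite mulrAC ler_wpM2r.
move=> z1 y1; have := sqr_le_coef z0 y0 z1 y1.
have -> : (1 + z) / (x * (1 - z) * (1 - y)) = (1 + z) / ((1 - z) * (1 - y)) / x.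
  by rewrite -[x * _ * _]mulrA invfM mulrCA mulrC.
set c := (1 + z) / (_ * _) => c_ge.
have c0 : 0 <= c by apply: le_trans c_ge; rewrite mulr_ge0 ?addr_ge0.
split.
  rewrite mulrAC ler_wpM2r //; apply: le_trans dw _.
  rewrite ler_wpM2r ?addr_ge0 ?mulr_ge0 //; apply: le_trans c_ge.
  exact: ler_pM.
rewrite -mulrA ler_wpM2l //.
have [-> | xN0] := eqVneq x 0; first by rewrite invr0 mul0r !addr_ge0.
rewrite mulrC ler_pdivrMr ?lt_def ?xN0 // mulrDl [g2 * x]mulrC lerD2r.
by rewrite mulrC.
Qed.

End ScalarEstimates.

(** * Conjugate transposes *)

Section Adjoint.
Set Implicit Arguments.
Unset Strict Implicit.
Context {C : numClosedFieldType}.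

Lemma adjmxM m n p (M : 'M[C]_(m, n)) (N : 'M_(n, p)) :
  (M *m N) ^t* = N ^t* *m M ^t*.
Proof. by rewrite trmx_mul map_mxM. Qed.

Lemma adjmxD m n (M N : 'M[C]_(m, n)) : (M + N) ^t* = M ^t* + N ^t*.
Proof. by rewrite linearD map_mxD. Qed.

Lemma adjmxB m n (M N : 'M[C]_(m, n)) : (M - N) ^t* = M ^t* - N ^t*.
Proof. by rewrite linearB map_mxB. Qed.

Lemma adjmx1 n : (1%:M : 'M[C]_n) ^t* = 1%:M.
Proof. by rewrite trmx1 map_mx1. Qed.

Lemma adjmx_inv n (M : 'M[C]_n) : (invmx M) ^t* = invmx (M ^t*).
Proof. by rewrite trmx_inv map_invmx. Qed.

End Adjoint.

(** * The Euclidean norm *)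

Section EuclideanNorm.
Set Implicit Arguments.
Unset Strict Implicit.
Context {R : realType}.

Lemma l2norm_ge0 n (x : 'cV[R[i]]_n) : 0 <= l2norm x.
Proof. exact: sqrtr_ge0. Qed.

Lemma l2norm_sqrE n (x : 'cV[R[i]]_n) :
  ((l2norm x ^+ 2)%:C)%C = (x ^t* *m x) 0 0.
Proof.
rewrite sqr_sqrtr; last by apply: sumr_ge0 => j _; exact: sqr_ge0.
rewrite mxE rmorph_sum; apply: eq_bigr => j _; rewrite !mxE mulrC.
by rewrite rmorphXn /= -normCK; congr (_ ^+ 2); case: (x j 0).
Qed.

(** Transfers Cauchy-Schwarz and the triangle inequality from the dot product
    on row vectors. *)
Lemma l2norm_dotmx n (x : 'cV[R[i]]_n) :
  ((l2norm x)%:C)%C = sqrtC (dotmx x^T x^T).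
Proof.
have -> : dotmx x^T x^T = ((l2norm x)%:C)%C ^+ 2.
  rewrite -rmorphXn /= l2norm_sqrE dotmxE !mxE; apply: eq_bigr => j _.
  by rewrite !mxE mulrC.
by rewrite sqrCK // lecR l2norm_ge0.
Qed.

Lemma l2normD n (x y : 'cV[R[i]]_n) : l2norm (x + y) <= l2norm x + l2norm y.
Proof.
rewrite -lecR rmorphD /= !l2norm_dotmx linearD /=.
by have [] := triangle_lerif (@dotmx R[i] n) x^T y^T.
Qed.

Lemma l2norm_CauchySchwarz n (x y : 'cV[R[i]]_n) :
  `|(y ^t* *m x) 0 0| <= ((l2norm x * l2norm y)%:C)%C.
Proof.
rewrite rmorphM /= !l2norm_dotmx.
have -> : (y ^t* *m x) 0 0 = dotmx x^T y^T.
  by rewrite dotmxE !mxE; apply: eq_bigr => j _; rewrite !mxE mulrC.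
by have [] := CauchySchwarz_sqrt (@dotmx R[i] n) x^T y^T.
Qed.

Lemma l2normZ n (a : R[i]) (x : 'cV[R[i]]_n) :
  l2norm (a *: x) = Normc.normc a * l2norm x.
Proof.
have na0 : 0 <= Normc.normc a by case: a => ? ?; exact: sqrtr_ge0.
rewrite /l2norm -[Normc.normc a in RHS]ger0_norm // -sqrtr_sqr.
rewrite -sqrtrM ?sqr_ge0 //.
rewrite mulr_sumr; congr Num.sqrt; apply: eq_bigr => j _.
by rewrite mxE Normc.normcM exprMn.
Qed.

Lemma l2norm0 n : l2norm (0 : 'cV[R[i]]_n) = 0.
Proof. by rewrite -(scale0r 0) l2normZ Normc.normc0 mul0r. Qed.

Lemma normc_le_l2norm n (x : 'cV[R[i]]_n) j : Normc.normc (x j 0) <= l2norm x.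
Proof.
have nx0 : 0 <= Normc.normc (x j 0) by case: (x j 0) => ? ?; exact: sqrtr_ge0.
rewrite -[leLHS](ger0_norm nx0) -sqrtr_sqr ler_wsqrtr // (bigD1 j) //=.
by rewrite lerDl sumr_ge0 // => i _; exact: sqr_ge0.
Qed.

Lemma l2norm_eq0 n (x : 'cV[R[i]]_n) : l2norm x = 0 -> x = 0.
Proof.
move=> x0; apply/colP=> j; rewrite mxE; apply: Normc.eq0_normc; apply/le_anti.
rewrite -{1}x0 normc_le_l2norm /=; case: (x j 0) => ? ?; exact: sqrtr_ge0.
Qed.

Lemma l2norm_sum n I (r : seq I) (f : I -> 'cV[R[i]]_n) :
  l2norm (\sum_(i <- r) f i) <= \sum_(i <- r) l2norm (f i).
Proof.
elim/big_ind2: _ => [|x a y b xa yb|//]; first by rewrite l2norm0.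
by apply: le_trans (l2normD _ _) _; exact: lerD.
Qed.

(** A crude bound, whose only purpose is that the supremum defining the
    spectral norm is finite. *)
Lemma l2norm_mulmx_bounded m n (M : 'M[R[i]]_(m, n)) (x : 'cV_n) :
  l2norm (M *m x) <= (\sum_j l2norm (col j M)) * l2norm x.
Proof.
have -> : M *m x = \sum_j x j 0 *: col j M.
  apply/colP=> i; rewrite summxE mxE; apply: eq_bigr => j _.
  by rewrite !mxE mulrC.
rewrite mulr_suml; apply: le_trans (l2norm_sum _ _) _.
apply: ler_sum => j _; rewrite l2normZ mulrC ler_wpM2l ?l2norm_ge0 //.
exact: normc_le_l2norm.
Qed.

End EuclideanNorm.

(** * The spectral norm *)

Section SpectralNorm.
Set Implicit Arguments.
Unset Strict Implicit.
Context {R : realType}.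

Lemma spectral_norm_has_sup m n (M : 'M[R[i]]_(m, n)) :
  has_sup [set l2norm (M *m x) |
    x in [set x : 'cV[R[i]]_n | l2norm x <= 1]]%classic.
Proof.
split; first by exists (l2norm (M *m 0)), 0 => //=; rewrite l2norm0.
exists (\sum_j l2norm (col j M)) => _ [x /= x1 <-].
apply: le_trans (l2norm_mulmx_bounded _ _) _.
by rewrite ler_piMr // sumr_ge0 // => j _; exact: l2norm_ge0.
Qed.

Lemma spectral_norm_ge0 m n (M : 'M[R[i]]_(m, n)) : 0 <= spectral_norm M.
Proof.
apply: le_trans (l2norm_ge0 (M *m 0)) _.
apply: sup_upper_bound; first exact: spectral_norm_has_sup.
by exists 0 => //=; rewrite l2norm0.
Qed.

Lemma l2norm_mulmx m n (M : 'M[R[i]]_(m, n)) x :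
  l2norm (M *m x) <= spectral_norm M * l2norm x.
Proof.
have [/l2norm_eq0 -> | x0] := eqVneq (l2norm x) 0.
  by rewrite mulmx0 !l2norm0 mulr0.
have xp : 0 < l2norm x by rewrite lt_def x0 l2norm_ge0.
pose c : R[i] := ((l2norm x)^-1%:C)%C.
have nc : Normc.normc c = (l2norm x)^-1.
  by rewrite /= expr0n addr0 sqrtr_sqr ger0_norm // invr_ge0 ltW.
rewrite -ler_pdivrMr // mulrC -nc -l2normZ scalemxAr.
apply: sup_upper_bound; first exact: spectral_norm_has_sup.
by exists (c *: x) => //=; rewrite l2normZ nc mulVf.
Qed.

Lemma spectral_norm_le m n (M : 'M[R[i]]_(m, n)) c : 0 <= c ->
  (forall x, l2norm (M *m x) <= c * l2norm x) -> spectral_norm M <= c.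
Proof.
move=> c0 Mc; apply: ge_sup; first by have [] := spectral_norm_has_sup M.
by move=> _ [x /= x1 <-]; apply: le_trans (Mc x) _; rewrite ler_piMr.
Qed.

Lemma spectral_normD m n (M N : 'M[R[i]]_(m, n)) :
  spectral_norm (M + N) <= spectral_norm M + spectral_norm N.
Proof.
apply: spectral_norm_le => [|x]; first by rewrite addr_ge0 ?spectral_norm_ge0.
rewrite mulmxDl mulrDl; apply: le_trans (l2normD _ _) _.
by apply: lerD; exact: l2norm_mulmx.
Qed.

Lemma spectral_normN m n (M : 'M[R[i]]_(m, n)) :
  spectral_norm (- M) = spectral_norm M.
Proof.
suff le_norm (N : 'M[R[i]]_(m, n)) : spectral_norm (- N) <= spectral_norm N.
  by apply/le_anti; rewrite le_norm -{1}[M]opprK le_norm.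
apply: spectral_norm_le => [|x]; first exact: spectral_norm_ge0.
have -> : l2norm (- N *m x) = l2norm (N *m x).
  by rewrite mulNmx -scaleN1r l2normZ normcN Normc.normc1 mul1r.
exact: l2norm_mulmx.
Qed.

Lemma spectral_normB m n (M N : 'M[R[i]]_(m, n)) :
  spectral_norm (M - N) <= spectral_norm M + spectral_norm N.
Proof. by apply: le_trans (spectral_normD _ _) _; rewrite spectral_normN. Qed.

Lemma spectral_normM m n p (M : 'M[R[i]]_(m, n)) (N : 'M_(n, p)) :
  spectral_norm (M *m N) <= spectral_norm M * spectral_norm N.
Proof.
apply: spectral_norm_le => [|x]; first by rewrite mulr_ge0 ?spectral_norm_ge0.
rewrite -mulmxA -mulrA; apply: le_trans (l2norm_mulmx _ _) _.
by rewrite ler_wpM2l ?spectral_norm_ge0 // l2norm_mulmx.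
Qed.

Lemma spectral_norm1 n : spectral_norm (1%:M : 'M[R[i]]_n) <= 1.
Proof. by apply: spectral_norm_le => // x; rewrite mul1mx mul1r. Qed.

(** |M^* x|^2 is the inner product of M M^* x and x, hence at most
    |M| |M^* x| |x| by Cauchy-Schwarz. *)
Lemma spectral_norm_adj m n (M : 'M[R[i]]_(m, n)) :
  spectral_norm (M ^t*) = spectral_norm M.
Proof.
suff le_norm p q (N : 'M[R[i]]_(p, q)) :
    spectral_norm (N ^t*) <= spectral_norm N.
  by apply/le_anti; rewrite le_norm -{1}[M]trmxCK le_norm.
apply: spectral_norm_le => [|x]; first exact: spectral_norm_ge0.
set y := N ^t* *m x.
have [-> | y0] := eqVneq (l2norm y) 0.
  by rewrite mulr_ge0 ?spectral_norm_ge0 ?l2norm_ge0.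
have yp : 0 < l2norm y by rewrite lt_def y0 l2norm_ge0.
rewrite -(ler_pM2r yp) -expr2.
apply: (@le_trans _ _ (l2norm x * l2norm (N *m y))); last first.
  rewrite mulrC mulrAC.
  by apply: ler_wpM2r; [exact: l2norm_ge0 | exact: l2norm_mulmx].
rewrite -lecR; apply: le_trans (l2norm_CauchySchwarz _ _).
rewrite adjmxM -mulmxA -l2norm_sqrE.
by rewrite ger0_norm // lecR sqr_ge0.
Qed.

(** 1 + Z^* Z is the Gram matrix of the columns of the block matrix with
    blocks 1 and Z, which has full column rank. *)
Lemma unitmx_add1_gram m n (Z : 'M[R[i]]_(m, n)) :
  1%:M + Z ^t* *m Z \in unitmx.
Proof.
have <- : (col_mx 1%:M Z) ^t* *m col_mx 1%:M Z = 1%:M + Z ^t* *m Z.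
  by rewrite tr_col_mx map_row_mx mul_row_col adjmx1 mul1mx.
apply: gram_unit; apply/eqP; rewrite eqn_leq rank_leq_col /=.
rewrite -{1}(mxrank1 R[i] n); apply: mxrankS; apply/submxP.
by exists (row_mx 1%:M 0); rewrite mul_row_col mul1mx mul0mx addr0.
Qed.

(** With y the preimage of x, |x|^2 = |(1 + Z^* Z) y|^2 expands to
    |y|^2 + 2 |Z y|^2 + |Z^* Z y|^2, which dominates |y|^2. *)
Lemma spectral_norm_inv_add1_gram m n (Z : 'M[R[i]]_(m, n)) :
  spectral_norm (invmx (1%:M + Z ^t* *m Z)) <= 1.
Proof.
set S := 1%:M + _; apply: spectral_norm_le => // x; rewrite mul1r.
set y := invmx S *m x.
have -> : x = y + Z ^t* *m (Z *m y).
  by rewrite mulmxA -{1}[y]mul1mx -mulmxDl mulKVmx // unitmx_add1_gram.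
have ysq : l2norm (y + Z ^t* *m (Z *m y)) ^+ 2 =
    l2norm y ^+ 2 + l2norm (Z *m y) ^+ 2 + l2norm (Z *m y) ^+ 2
      + l2norm (Z ^t* *m (Z *m y)) ^+ 2.
  apply: (@complexI R); rewrite !rmorphD /= !l2norm_sqrE.
  have addE (U V : 'M[R[i]]_1) : (U + V) 0 0 = U 0 0 + V 0 0 by rewrite mxE.
  rewrite -!addE adjmxD mulmxDl !mulmxDr !adjmxM !trmxCK !mulmxA.
  by rewrite !addrA.
rewrite -(@ler_pXn2r _ 2) ?nnegrE ?l2norm_ge0 // ysq -!addrA lerDl.
by rewrite !addr_ge0 ?sqr_ge0.
Qed.

End SpectralNorm.

(** * Core parts and their inverses *)

Section CorePair.
Set Implicit Arguments.
Unset Strict Implicit.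
Context {C : numClosedFieldType} {n : nat}.
Implicit Types A X : 'M[C]_n.

(** X is both the group inverse and the Moore-Penrose inverse of A A X, the
    core part of A.  These index-free equations hold for the core-EP inverse
    and are all that its perturbation theory uses. *)
Definition core_pair A X : Prop :=
  [/\ A *m X *m X = X, X *m A *m X = X, X *m (A *m (A *m X)) = A *m X &
      (A *m X) ^t* = A *m X].

Variables A X : 'M[C]_n.
Hypothesis AX_pair : core_pair A X.

Lemma core_proj_idem : A *m X *m (A *m X) = A *m X.
Proof. by have [_ X2 _ _] := AX_pair; rewrite -mulmxA [X *m _]mulmxA X2. Qed.

Lemma core_inv_projr : X *m (A *m X) = X.
Proof. by have [_ X2 _ _] := AX_pair; rewrite mulmxA. Qed.

Lemma core_part_mul_inv : A *m (A *m X) *m X = A *m X.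
Proof.
by have [X1 _ _ _] := AX_pair; rewrite -!mulmxA [A *m (X *m _)]mulmxA X1.
Qed.

Lemma core_part_projr : A *m (A *m X) *m (A *m X) = A *m (A *m X).
Proof. by rewrite -mulmxA core_proj_idem. Qed.

Lemma core_part_projl : A *m X *m (A *m (A *m X)) = A *m (A *m X).
Proof. by have [_ _ X3 _] := AX_pair; rewrite -mulmxA X3. Qed.

End CorePair.

(** * The oblique projector of two idempotents *)

Section ObliqueProjector.
Set Implicit Arguments.
Unset Strict Implicit.
Context {C : numClosedFieldType} {n : nat}.
Variables P Q : 'M[C]_n.
Hypothesis PP : P *m P = P.
Hypothesis QQ : Q *m Q = Q.
Let D := 1%:M - (P - Q) ^+ 2.

(** The projector onto the range of Q along the kernel of P; the four products
    with P and Q below characterize it. *)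
Definition oblique_proj : 'M[C]_n := Q *m P *m invmx D.

Let sqrD : (P - Q) ^+ 2 = P + Q - P *m Q - Q *m P.
Proof.
rewrite expr2 -mulmxE mulmxBl !mulmxBr PP QQ opprB addrA.
by rewrite [P - _ + Q]addrAC.
Qed.

(* D commutes with both idempotents, and compresses to P Q P and Q P Q. *)
Let PD : P *m D = P *m Q *m P.
Proof.
rewrite /D mulmxBr mulmx1 sqrD !mulmxBr mulmxDr PP !mulmxA PP addrK.
by rewrite opprB addrC subrK.
Qed.

Let DP : D *m P = P *m Q *m P.
Proof.
rewrite /D mulmxBl mul1mx sqrD !mulmxBl mulmxDl PP -[Q *m P *m P]mulmxA PP.
by rewrite addrAC addrK opprB addrC subrK.
Qed.

Let QD : Q *m D = Q *m P *m Q.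
Proof.
rewrite /D mulmxBr mulmx1 sqrD !mulmxBr mulmxDr QQ !mulmxA QQ.
by rewrite addrAC [_ + Q]addrC addrK opprB addrC subrK.
Qed.

Let DQ : D *m Q = Q *m P *m Q.
Proof.
rewrite /D mulmxBl mul1mx sqrD !mulmxBl mulmxDl QQ -[P *m Q *m Q]mulmxA QQ.
by rewrite [_ + Q]addrC addrK opprB addrC subrK.
Qed.

Hypothesis Du : D \in unitmx.

Let commP : P *m invmx D = invmx D *m P.
Proof.
by apply: (can_inj (mulKmx Du)); rewrite mulKVmx // mulmxA DP -PD mulmxK.
Qed.

Let commQ : Q *m invmx D = invmx D *m Q.
Proof.
by apply: (can_inj (mulKmx Du)); rewrite mulKVmx // mulmxA DQ -QD mulmxK.
Qed.

Let compressP : P *m invmx D *m Q *m P = P.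
Proof. by rewrite commP -!mulmxA [P *m (Q *m P)]mulmxA -DP mulKmx. Qed.

Lemma oblique_proj_mulrQ : oblique_proj *m Q = Q.
Proof. by rewrite /oblique_proj -mulmxA -commQ mulmxA -QD mulmxK. Qed.

Lemma oblique_proj_mullQ : Q *m oblique_proj = oblique_proj.
Proof. by rewrite /oblique_proj !mulmxA QQ. Qed.

Lemma oblique_proj_mullP : P *m oblique_proj = P.
Proof. by rewrite /oblique_proj !mulmxA -PD mulmxK. Qed.

Lemma oblique_proj_mulrP : oblique_proj *m P = oblique_proj.
Proof. by rewrite /oblique_proj -mulmxA -commP mulmxA -(mulmxA Q P P) PP. Qed.

Lemma oblique_proj_idem : oblique_proj *m oblique_proj = oblique_proj.
Proof.
by rewrite -{2}oblique_proj_mullQ mulmxA oblique_proj_mulrQ oblique_proj_mullQ.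
Qed.

(** V inverts L on the range of Q.  The resolvent N sends the range of P onto
    that of Q through L X and fixes the kernel of P, so it conjugates P into
    the oblique projector.  L is kept abstract because both the core part of
    B and its adjoint will take its place. *)
Section Resolvent.
Variables A X L V : 'M[C]_n.
Hypothesis AX : A *m X = P.
Hypothesis PX : P *m X = X.
Hypothesis QL : Q *m L = L.
Hypothesis VL : V *m L = Q.

Let N := 1%:M + (L - A) *m X.

Let NE : N = 1%:M - P + L *m X.
Proof. by rewrite /N mulmxBl AX addrA addrAC. Qed.

Lemma oblique_proj_resolvent : oblique_proj *m N = L *m X.
Proof.
rewrite NE mulmxDr mulmxBr mulmx1 oblique_proj_mulrP subrr add0r.
by rewrite -QL !mulmxA oblique_proj_mulrQ.
Qed.

Lemma resolvent_unit : N \in unitmx.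
Proof.
(* The left inverse of N is the identity on the kernel of P.  On the range of
   Q, V undoes L, P D^-1 undoes the passage from the range of P to that of Q,
   and A undoes X. *)
have: (A *m P *m invmx D *m V *m oblique_proj + (1%:M - oblique_proj)) *m N =
    1%:M.
  rewrite mulmxDl mulmxBl mul1mx -mulmxA oblique_proj_resolvent NE addrK.
  rewrite mulmxA -[_ *m V *m L]mulmxA VL -PX mulmxA.
  rewrite -[A *m P *m _]mulmxA -[A *m _ *m Q]mulmxA -[A *m _ *m P]mulmxA.
  by rewrite compressP -mulmxA PX AX addrC subrK.
by case/mulmx1_unit.
Qed.

Lemma resolvent_projC :
  (1%:M - P) *m (L - A) *m X *m invmx N = oblique_proj - P.
Proof.
apply: (can_inj (mulmxK resolvent_unit)); rewrite mulmxKV ?resolvent_unit //.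
have -> : (1%:M - P) *m (L - A) *m X = (1%:M - P) *m (L *m X).
  rewrite -mulmxA [(L - A) *m X]mulmxBl AX mulmxBr.
  by rewrite [(1%:M - P) *m P]mulmxBl mul1mx PP subrr subr0.
rewrite -oblique_proj_resolvent mulmxA [(1%:M - P) *m _]mulmxBl mul1mx.
by rewrite oblique_proj_mullP.
Qed.

End Resolvent.

End ObliqueProjector.

(** * Factorization of the perturbed inverse *)

Section StableFactor.
Set Implicit Arguments.
Unset Strict Implicit.
Context {C : numClosedFieldType} {n : nat}.
Variables A X B V : 'M[C]_n.
Hypothesis AX_pair : core_pair A X.
Hypothesis BV_pair : core_pair B V.
Let P := A *m X.
Let Q := B *m V.
Let L := B *m Q.
Hypothesis sep_unit : 1%:M - (P - Q) ^+ 2 \in unitmx.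
Let Pi := oblique_proj P Q.
Let N := 1%:M + (L - A) *m X.
Let Z := (1%:M - P) *m (L - A) *m X *m invmx N.
Let Y := invmx (1%:M + X ^t* *m (L - A ^t*))
  *m X ^t* *m (L - A ^t*) *m (1%:M - P).

Let PP : P *m P = P. Proof. exact: core_proj_idem. Qed.
Let QQ : Q *m Q = Q. Proof. exact: core_proj_idem. Qed.
Let PX : P *m X = X. Proof. by have [] := AX_pair. Qed.
Let Pa : P ^t* = P. Proof. by have [] := AX_pair. Qed.
Let Qa : Q ^t* = Q. Proof. by have [] := BV_pair. Qed.
Let QL : Q *m L = L. Proof. exact: core_part_projl. Qed.
Let LQ : L *m Q = L. Proof. exact: core_part_projr. Qed.
Let VL : V *m L = Q. Proof. by have [] := BV_pair. Qed.
Let LV : L *m V = Q. Proof. exact: core_part_mul_inv. Qed.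

Lemma stable_resolvent_unit : N \in unitmx.
Proof. exact: (resolvent_unit PP QQ sep_unit (erefl P) PX QL VL). Qed.

Let ZE : Z = Pi - P.
Proof. exact: (resolvent_projC PP QQ sep_unit (erefl P) PX QL VL). Qed.

(** The adjoint of Y is the expression defining Z with L replaced by its
    adjoint, and the value Pi - P of that expression does not depend on L. *)
Lemma stable_Y_adj : Y = Z ^t*.
Proof.
have QLa : Q *m L ^t* = L ^t* by rewrite -{1}Qa -adjmxM LQ.
have VLa : V ^t* *m L ^t* = Q by rewrite -adjmxM LV.
have Na : (1%:M + X ^t* *m (L - A ^t*)) ^t* = 1%:M + (L ^t* - A) *m X.
  by rewrite adjmxD adjmx1 adjmxM adjmxB !trmxCK.
rewrite -[Y]trmxCK ZE -(resolvent_projC PP QQ sep_unit (erefl P) PX QLa VLa).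
congr (_ ^t*).
rewrite /Y adjmxM 2!adjmxM adjmx_inv Na trmxCK !adjmxB adjmx1 trmxCK Pa.
by rewrite !mulmxA.
Qed.

Let PiQ : Pi *m Q = Q. Proof. exact: oblique_proj_mulrQ. Qed.
Let QPi : Q *m Pi = Pi. Proof. exact: oblique_proj_mullQ. Qed.
Let PPi : P *m Pi = P. Proof. exact: oblique_proj_mullP. Qed.
Let PiP : Pi *m P = Pi. Proof. exact: oblique_proj_mulrP. Qed.
Let PiPi : Pi *m Pi = Pi. Proof. exact: oblique_proj_idem. Qed.

Lemma stable_Z_sqr0 : Z *m Z = 0.
Proof. by rewrite ZE mulmxBl !mulmxBr PP PiPi PiP PPi !subrr. Qed.

Let S := 1%:M + Z ^t* *m Z.
Let W := S *m (1%:M - Z).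

Let WPi : W *m Pi = Pi ^t* *m Pi.
Proof.
have -> : W *m Pi = S *m P.
  rewrite -mulmxA; congr (_ *m _).
  by rewrite ZE mulmxBl mul1mx mulmxBl PiPi PPi opprB addrC subrK.
have PiaP : Pi ^t* *m P = P by rewrite -{1}Pa -adjmxM PPi.
rewrite mulmxDl mul1mx -mulmxA ZE mulmxBl PiP PP adjmxB Pa mulmxBl !mulmxBr.
by rewrite PPi PP PiaP subrr subr0 addrC subrK.
Qed.

(** V lives on the range of Q, on which W acts as the adjoint of Pi, so that
    the left-hand side is Pi^* V Pi.  Multiplying it by N turns Pi into L X,
    and V L = Q lets everything collapse to X. *)
Lemma stable_factor : W *m V *m W ^t* = X *m invmx N.
Proof.
have PiV : Pi *m V = V.
  have [V1 _ _ _] := BV_pair.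
  by rewrite -{1}V1 !mulmxA -[Pi *m _ *m _]mulmxA PiQ.
have VPi : V *m Pi ^t* = V.
  rewrite -{1}(core_inv_projr BV_pair) -/Q -mulmxA -{1}Qa -adjmxM PiQ Qa.
  exact: core_inv_projr.
have WV : W *m V = Pi ^t* *m V by rewrite -{1}PiV mulmxA WPi -mulmxA PiV.
have VW : V *m W ^t* = V *m Pi.
  by rewrite -{1}VPi -mulmxA -adjmxM WPi adjmxM trmxCK mulmxA VPi.
rewrite WV -mulmxA VW mulmxA.
have PiN : Pi *m N = L *m X.
  exact: (oblique_proj_resolvent PP QQ sep_unit (erefl P) QL).
apply: (can_inj (mulmxK stable_resolvent_unit)).
rewrite /= (mulmxKV stable_resolvent_unit).
rewrite -[_ *m Pi *m N]mulmxA PiN mulmxA -[_ *m V *m _]mulmxA VL.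
have -> : Pi ^t* *m Q = Pi ^t* by rewrite -{1}Qa -adjmxM QPi.
by rewrite -{1}PX mulmxA -{1}Pa -adjmxM PPi Pa.
Qed.

(** 1 + Z inverts 1 - Z since Z squares to zero. *)
Lemma stable_W_inv : S \in unitmx ->
  W \in unitmx /\ invmx W = (1%:M + Z) *m invmx S.
Proof.
move=> Su; have WK : W *m ((1%:M + Z) *m invmx S) = 1%:M.
  rewrite -mulmxA [(_ - _) *m _]mulmxA mulmxBl mul1mx mulmxDr stable_Z_sqr0.
  by rewrite mulmx1 addr0 addrK mul1mx mulmxV.
have [Wu _] := mulmx1_unit WK; split=> //.
by apply: (can_inj (mulKmx Wu)); rewrite WK mulmxV.
Qed.

End StableFactor.

(** * The core-EP inverse *)

Section CoreEPPair.
Set Implicit Arguments.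
Unset Strict Implicit.
Context {R : realType} {n : nat}.
Implicit Types A M : 'M[R[i]]_n.

Lemma core_EP_sqr M : M *m core_EP M *m core_EP M = core_EP M.
Proof. by have [_ X2 _] := core_EPP M; rewrite -mulmxA. Qed.

Lemma core_EP_iter M j : core_EP M = M ^+ j *m core_EP M ^+ j.+1.
Proof.
elim: j => [|j IHj]; first by rewrite mul1mx.
have MX : M *m core_EP M ^+ j.+2 = core_EP M ^+ j.+1.
  by rewrite !exprS -!mulmxE !mulmxA core_EP_sqr.
by rewrite {1}IHj (exprSr M) -mulmxE -mulmxA MX.
Qed.

Lemma core_EP_proj_iter M :
  M *m core_EP M = M ^+ (mx_index M).+1 *m core_EP M ^+ (mx_index M).+1.
Proof. by rewrite {1}(core_EP_iter M (mx_index M)) mulmxA (exprS M). Qed.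

(** A core-EP inverse X satisfies X = M^j X^(j+1) for every j; at j the index
    of M, the defining equation then lets X cancel a factor M. *)
Lemma core_EP_pair M : core_pair M (core_EP M).
Proof.
have [X1 _ X3] := core_EPP M; split=> //; first exact: core_EP_sqr.
  by rewrite -mulmxA core_EP_proj_iter mulmxA X1 -core_EP_iter.
rewrite core_EP_proj_iter [M *m (_ *m _)]mulmxA.
have -> : M *m M ^+ (mx_index M).+1 = M ^+ (mx_index M).+1 *m M.
  by rewrite !mulmxE -exprS exprSr.
by rewrite !mulmxA X1 mulmxE -exprSr.
Qed.

End CoreEPPair.

(** * Perturbation of the core-EP inverse *)

Section CoreEPPerturbation.
Set Implicit Arguments.
Unset Strict Implicit.
Context {R : realType} {n : nat}.
Variables A B : 'M[R[i]]_n.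
Hypothesis stableAB : stable_perturbation A B.
Let Z := pertZ A B.

Let sep_unit :
  1%:M - (A *m core_EP A - B *m core_EP B) ^+ 2 \in unitmx.
Proof.
move: stableAB; rewrite /stable_perturbation /core_EP_pi.
by rewrite opprB [1%:M - B *m _ + _]addrC addrA subrK.
Qed.

Let pertL_B : pertL B = B *m (B *m core_EP B).
Proof. by rewrite /pertL expr2 mulmxA. Qed.

Let pairA := core_EP_pair A.
Let pairB := core_EP_pair B.

Lemma pertY_adj : pertY A B = Z ^t*.
Proof.
rewrite /Z /pertY /pertZ /pertE /pertF pertL_B.
exact: (stable_Y_adj pairA pairB sep_unit).
Qed.

Lemma pertZ_sqr0 : Z *m Z = 0.
Proof.
rewrite /Z /pertZ /pertE pertL_B.
exact: (stable_Z_sqr0 pairA pairB sep_unit).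
Qed.

Lemma pertW1E : pertW1 A B = (1%:M + Z ^t* *m Z) *m (1%:M - Z).
Proof. by rewrite /pertW1 pertY_adj. Qed.

Lemma pertW1_expand : pertW1 A B = 1%:M + pertY A B *m Z - Z.
Proof.
rewrite /pertW1 -/Z mulmxBr mulmx1; congr (_ - _).
by rewrite mulmxDl mul1mx -[_ *m Z *m Z]mulmxA pertZ_sqr0 mulmx0 addr0.
Qed.

Lemma pertW2_adj : pertW2 A B = (pertW1 A B) ^t*.
Proof.
by rewrite pertW1E adjmxM adjmxB adjmxD adjmx1 [(_ *m Z) ^t*]adjmxM trmxCK.
Qed.

Lemma pertW2_expand : pertW2 A B = 1%:M + Z ^t* *m Z - Z ^t*.
Proof.
rewrite pertW2_adj pertW1_expand pertY_adj.
by rewrite adjmxB adjmxD adjmx1 [(_ *m Z) ^t*]adjmxM trmxCK.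
Qed.

Lemma pertW1_inv : pertW1 A B \in unitmx /\
  invmx (pertW1 A B) = (1%:M + Z) *m invmx (1%:M + Z ^t* *m Z).
Proof.
rewrite pertW1E; move: (unitmx_add1_gram Z); rewrite /Z /pertZ /pertE pertL_B.
exact: (stable_W_inv pairA pairB sep_unit).
Qed.

(** With W2 = W1^*, this is the exact relation between the two core-EP
    inverses from which all the estimates follow. *)
Lemma core_EP_factor : pertW1 A B *m core_EP B *m pertW2 A B =
  core_EP A *m invmx (1%:M + pertE A B *m core_EP A).
Proof.
rewrite pertW2_adj pertW1E /Z /pertZ /pertE pertL_B.
exact: (stable_factor pairA pairB sep_unit).
Qed.

Lemma spectral_norm_inv_pertW1 :
  spectral_norm (invmx (pertW1 A B)) <= 1 + spectral_norm Z.
Proof.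
have [_ ->] := pertW1_inv; apply: le_trans (spectral_normM _ _) _.
rewrite -[leRHS]mulr1; apply: ler_pM; rewrite ?spectral_norm_ge0 //.
  by apply: le_trans (spectral_normD _ _) _; rewrite lerD2r spectral_norm1.
exact: spectral_norm_inv_add1_gram.
Qed.

Lemma spectral_norm_inv_pertW2 :
  spectral_norm (invmx (pertW2 A B)) <= 1 + spectral_norm Z.
Proof.
by rewrite pertW2_adj -adjmx_inv spectral_norm_adj spectral_norm_inv_pertW1.
Qed.

Let Ad := core_EP A.
Let G1 := Ad -
  (1%:M + pertY A B *m Z - Z) *m Ad *m (1%:M + Z ^t* *m Z - Z ^t*).
Let G2 := invmx (1%:M + pertE A B *m Ad) - 1%:M.

Let G1E : G1 = Ad - pertW1 A B *m Ad *m pertW2 A B.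
Proof. by rewrite pertW1_expand pertW2_expand. Qed.

Lemma core_EP_diff_factor : core_EP B - Ad =
  invmx (pertW1 A B) *m (G1 + Ad *m G2) *m invmx (pertW2 A B).
Proof.
have [W1u _] := pertW1_inv.
have W2u : pertW2 A B \in unitmx by rewrite pertW2_adj map_unitmx unitmx_tr.
have -> : G1 + Ad *m G2 = pertW1 A B *m (core_EP B - Ad) *m pertW2 A B.
  rewrite G1E /G2 [Ad *m (_ - _)]mulmxBr mulmx1 -core_EP_factor.
  by rewrite [LHS]addrC addrA subrK mulmxBr mulmxBl.
by rewrite mulmxA (mulmxK W2u) (mulKmx W1u).
Qed.

Lemma spectral_norm_core_EP_diff_le : spectral_norm (core_EP B - Ad) <=
  spectral_norm (invmx (pertW1 A B)) * spectral_norm (invmx (pertW2 A B)) *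
    (spectral_norm G1 + spectral_norm Ad * spectral_norm G2).
Proof.
rewrite core_EP_diff_factor; apply: le_trans (spectral_normM _ _) _.
rewrite mulrAC ler_wpM2r ?spectral_norm_ge0 //.
apply: le_trans (spectral_normM _ _) _.
rewrite ler_wpM2l ?spectral_norm_ge0 //; apply: le_trans (spectral_normD _ _) _.
by rewrite lerD2l spectral_normM.
Qed.

Lemma spectral_norm_G1_le : spectral_norm G1 <= spectral_norm Ad *
  (1 + (1 + spectral_norm Z + spectral_norm (pertY A B *m Z))
       * (1 + spectral_norm Z + spectral_norm Z ^+ 2)).
Proof.
have norm_expand (M N : 'M[R[i]]_n) :
    spectral_norm (1%:M + M - N) <= 1 + spectral_norm N + spectral_norm M.
  apply: le_trans (spectral_normB _ _) _; rewrite addrAC lerD2r.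
  by apply: le_trans (spectral_normD _ _) _; rewrite lerD2r spectral_norm1.
apply: le_trans (spectral_normB _ _) _; rewrite mulrDr mulr1 lerD2l.
apply: le_trans (spectral_normM _ _) _; rewrite mulrA.
apply: ler_pM; rewrite ?spectral_norm_ge0 //.
  apply: le_trans (spectral_normM _ _) _; rewrite mulrC.
  by rewrite ler_wpM2l ?spectral_norm_ge0 // norm_expand.
apply: le_trans (norm_expand _ _) _.
rewrite spectral_norm_adj lerD2l; apply: le_trans (spectral_normM _ _) _.
by rewrite spectral_norm_adj expr2.
Qed.

End CoreEPPerturbation.

Theorem theorem3p6 (R : realType) (n k s : nat) (A B : 'M[R[i]]_n)
    (indA : mx_index A = k) (k_gt0 : (0 < k)%N) (indB : mx_index B = s)
    (stableAB : stable_perturbation A B) :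
  let Ad := core_EP A in
  let Bd := core_EP B in
  let Y := pertY A B in
  let Z := pertZ A B in
  let W1 := pertW1 A B in
  let W2 := pertW2 A B in
  let G1 := Ad - (1%:M + Y *m Z - Z) *m Ad *m (1%:M + Z ^t* *m Z - Z ^t*) in
  let G2 := invmx (1%:M + pertE A B *m Ad) - 1%:M in
  let alpha := 1 + spectral_norm Z + spectral_norm (Y *m Z) in
  let beta := 1 + spectral_norm Z + spectral_norm Z ^+ 2 in
  (spectral_norm (Bd - Ad) / spectral_norm Ad <=
     spectral_norm (invmx W1) * spectral_norm (invmx W2) / spectral_norm Ad
       * (spectral_norm G1 + spectral_norm Ad * spectral_norm G2)) /\
  (spectral_norm Z < 1 -> spectral_norm (Y *m Z) < 1 ->
     spectral_norm (Bd - Ad) / spectral_norm Ad <=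
       (1 + spectral_norm Z) /
         (spectral_norm Ad * (1 - spectral_norm Z)
            * (1 - spectral_norm (Y *m Z)))
         * (spectral_norm G1 + spectral_norm Ad * spectral_norm G2) /\
     (1 + spectral_norm Z) /
         (spectral_norm Ad * (1 - spectral_norm Z)
            * (1 - spectral_norm (Y *m Z)))
         * (spectral_norm G1 + spectral_norm Ad * spectral_norm G2) <=
       (1 + spectral_norm Z) /
         ((1 - spectral_norm Z) * (1 - spectral_norm (Y *m Z)))
         * (1 + alpha * beta + spectral_norm G2)).
Proof.
move=> Ad Bd Y Z W1 W2 G1 G2 alpha beta.
apply: relative_estimates; rewrite ?spectral_norm_ge0 //.
- by rewrite mulr_ge0 ?addr_ge0 ?exprn_ge0 ?spectral_norm_ge0.
- exact: spectral_norm_core_EP_diff_le.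
- exact: spectral_norm_inv_pertW1.
- exact: spectral_norm_inv_pertW2.
- exact: spectral_norm_G1_le.
Qed.
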